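(* In the setting described in the context, suppose Method 1 does not stop. Then the generated sequence $(x^k)_{k\in\mathbb N}$ converges weakly to some element of $\operatorname{zer}(A+B)$.
   Context: Let $\mathcal H$ be a real Hilbert space with inner product $\langle\cdot,\cdot\rangle$ and norm $\|\cdot\|$. Let $A_1:\mathcal H\to\mathcal H$ be $\beta$-cocoercive for some $\beta>0$ (i.e. $\langle A_1x-A_1y,x-y\rangle\ge\beta\|A_1x-A_1y\|^2$ for all $x,y$), let $A_2:\mathcal H\to\mathcal H$ be maximally monotone and uniformly continuous, let $B:\mathcal H\rightrightarrows\mathcal H$ be maximally monotone, and set $A:=A_1+A_2$. Assume $\operatorname{zer}(A+B):=\{x:0\in Ax+Bx\}\neq\emptyset$. $J_{\alpha B}:=(I+\alpha B)^{-1}$ for $\alpha>0$, and $P_C$ denotes the orthogonal projection onto a nonempty closed convex set $C$. Fix $\theta,\delta\in(0,1)$, $\bar\delta>0$ with $1-\delta-\bar\delta>0$, and $\alpha_{-1}>0$ with $\alpha_{-1}\le4\beta\bar\delta$. Conceptual Algorithm: pick $x^0\in\mathcal H$. Given $x^k$ and $\alpha_{k-1}$, for $j\in\mathbb N$ let $\bar x^k_j:=J_{\alpha_{k-1}\theta^jB}(x^k-\alpha_{k-1}\theta^jAx^k)$ and let $j(k)$ be the smallest $j\in\mathbb N$ with $\alpha_{k-1}\theta^j\langle A_2x^k-A_2\bar x^k_j,x^k-\bar x^k_j\rangle\le\delta\|x^k-\bar x^k_j\|^2$. Set $\alpha_k:=\alpha_{k-1}\theta^{j(k)}$, $\bar x^k:=J_{\alpha_kB}(x^k-\alpha_kAx^k)$,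 $r_k:=\frac{\bar\delta}{\alpha_k}\|x^k-\bar x^k\|^2$ and $T_k:=\{x\in\mathcal H:\langle \frac{x^k-\bar x^k}{\alpha_k}-(A_2x^k-A_2\bar x^k),x-\bar x^k\rangle\le r_k\}$. Method 1 sets $x^{k+1}:=P_{T_k}(x^k)$ and stops if $x^{k+1}=x^k$. *)

(* Defs.v *)
From HB Require Import structures.
From mathcomp Require Import all_boot all_order all_algebra.
From mathcomp Require Import all_classical all_reals all_analysis.
Set Implicit Arguments. Unset Strict Implicit. Unset Printing Implicit Defensive.
Import Order.TTheory GRing.Theory Num.Theory numFieldNormedType.Exports.
Local Open Scope ring_scope.
Local Open Scope classical_set_scope.

Section Hilbert.
Variables (R : realType) (V : lmodType R) (ip : V -> V -> R).

Definition hnorm (v : V) : R := Num.sqrt (ip v v).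

Record is_hilbert : Prop := {
  ip_sym : forall x y, ip x y = ip y x;
  ip_linl : forall (c : R) x y z, ip (c *: x + y) z = c * ip x z + ip y z;
  ip_ge0 : forall x, 0 <= ip x x;
  ip_eq0 : forall x, ip x x = 0 -> x = 0;
  ip_complete : forall u : nat -> V,
    (forall e : R, 0 < e -> exists N : nat, forall m n : nat,
        (N <= m)%N -> (N <= n)%N -> hnorm (u m - u n) < e) ->
    exists l : V, forall e : R, 0 < e -> exists N : nat, forall n : nat,
        (N <= n)%N -> hnorm (u n - l) < e }.

Definition weak_cvg (u : nat -> V) (l : V) : Prop :=
  forall y : V, (fun k => ip (u k) y) @ \oo --> ip l y.

Definition cocoercive (beta : R) (T : V -> V) : Prop :=
  forall x y, beta * ip (T x - T y) (T x - T y) <= ip (T x - T y) (x - y).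

(* set-valued operators are relations: B x u means u \in B x *)
Definition h_monotone (B : V -> V -> Prop) : Prop :=
  forall x u y v, B x u -> B y v -> 0 <= ip (x - y) (u - v).

Definition h_max_monotone (B : V -> V -> Prop) : Prop :=
  h_monotone B /\
  forall x u, (forall y v, B y v -> 0 <= ip (x - y) (u - v)) -> B x u.

Definition op_graph (T : V -> V) : V -> V -> Prop := fun x u => u = T x.

Definition h_unif_cont (T : V -> V) : Prop :=
  forall e : R, 0 < e -> exists d : R, 0 < d /\
    forall x y, hnorm (x - y) < d -> hnorm (T x - T y) < e.

(* p = J_{a B}(z) = (I + aB)^{-1} z, i.e. z \in p + a B p *)
Definition is_resolvent (B : V -> V -> Prop) (a : R) (z p : V) : Prop :=
  B p (a^-1 *: (z - p)).

Definition is_proj (C : set V) (x p : V) : Prop :=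
  C p /\ forall y, C y -> hnorm (x - p) <= hnorm (x - y).

Definition zer (A : V -> V) (B : V -> V -> Prop) : set V :=
  fun x => B x (- A x).

Definition Tk (A2 : V -> V) (dbar a : R) (x xb : V) : set V :=
  fun y => ip (a^-1 *: (x - xb) - (A2 x - A2 xb)) (y - xb)
           <= dbar / a * ip (x - xb) (x - xb).

Definition ls_test (A2 : V -> V) (delta c : R) (x p : V) : Prop :=
  c * ip (A2 x - A2 p) (x - p) <= delta * ip (x - p) (x - p).

(* Method 1.  [alpha 0] is alpha_{-1}, [alpha k.+1] is alpha_k;
   [xb k] is \bar x^k.  j(k) is the least j passing the linesearch test. *)
Definition method1 (A1 A2 : V -> V) (B : V -> V -> Prop)
    (theta delta dbar : R) (x0 : V) (am1 : R)
    (x : nat -> V) (alpha : nat -> R) (xb : nat -> V) : Prop :=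
  x 0%N = x0 /\ alpha 0%N = am1 /\
  forall k : nat,
    (exists j : nat,
        alpha k.+1 = alpha k * theta ^+ j /\
        (forall p, is_resolvent B (alpha k * theta ^+ j)
                     (x k - (alpha k * theta ^+ j) *: (A1 (x k) + A2 (x k))) p ->
                   ls_test A2 delta (alpha k * theta ^+ j) (x k) p) /\
        (forall i : nat, (i < j)%N -> forall p,
           is_resolvent B (alpha k * theta ^+ i)
             (x k - (alpha k * theta ^+ i) *: (A1 (x k) + A2 (x k))) p ->
           ~ ls_test A2 delta (alpha k * theta ^+ i) (x k) p)) /\
    is_resolvent B (alpha k.+1)
      (x k - alpha k.+1 *: (A1 (x k) + A2 (x k))) (xb k) /\
    is_proj (Tk A2 dbar (alpha k.+1) (x k) (xb k)) (x k) (x k.+1).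

End Hilbert.

(* Main.v *)
(* The distance to a zero of A + B decreases along the iteration, so by Opial's
   argument it suffices that weak limits of subsequences are zeros.  When the
   steps alpha_k tend to 0, the residuals |x^k - xbar^k| / alpha_k are only
   controlled at the indices where some backtracking takes place.  This control
   is propagated: if t w is the displacement x^k - x^{k+1}, the step is compared
   with the exact resolvent step y' = (I + t (A + B))^{-1} y from a nearby point y
   with small residual.  Resolvent steps do not increase the residual of y, and
   |x^k - y|^2 increases by at most a multiple of the decrease of the squared
   distance to a zero as long as the residual of x^k is not small.  The
   resolvents of B and of A + B exist by Minty's theorem, obtained by minimizing
   the Fitzpatrick function plus half the squared norm. *)
Require Import Defs.
From HB Require Import structures.
From mathcomp Require Import all_boot all_order all_algebra.
From mathcomp Require Import all_classical all_reals all_analysis.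
From mathcomp Require Import ring lra.
Set Implicit Arguments. Unset Strict Implicit. Unset Printing Implicit Defensive.
Import Order.TTheory GRing.Theory Num.Theory.
Local Open Scope ring_scope.

(** * Calculus of the inner product and its norm *)

Section Geometry.
Variables (R : realType) (V : lmodType R) (ip : V -> V -> R).
Hypothesis HV : is_hilbert ip.
Implicit Types (x y z : V) (a : R).
Local Notation nrm := (hnorm ip).

Lemma ipC x y : ip x y = ip y x. Proof. exact: ip_sym HV _ _. Qed.

Lemma ipDl x y z : ip (x + y) z = ip x z + ip y z.
Proof. by have := ip_linl HV 1 x y z; rewrite scale1r mul1r. Qed.

Lemma ip0l z : ip 0 z = 0.
Proof. by apply: (addrI (ip 0 z)); rewrite -ipDl !addr0. Qed.

Lemma ipZl a x z : ip (a *: x) z = a * ip x z.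
Proof. by have := ip_linl HV a x 0 z; rewrite ip0l !addr0. Qed.

Lemma ipNl x z : ip (- x) z = - ip x z.
Proof. by rewrite -scaleN1r ipZl mulN1r. Qed.

Lemma ipDr x y z : ip z (x + y) = ip z x + ip z y.
Proof. by rewrite !(ipC z) ipDl. Qed.

Lemma ip0r z : ip z 0 = 0. Proof. by rewrite ipC ip0l. Qed.

Lemma ipZr a x z : ip z (a *: x) = a * ip z x.
Proof. by rewrite !(ipC z) ipZl. Qed.

Lemma ipNr x z : ip z (- x) = - ip z x.
Proof. by rewrite !(ipC z) ipNl. Qed.

Definition ipE := (ipDl, ipDr, ipNl, ipNr, ipZl, ipZr, ip0l, ip0r).

Lemma hnorm_ge0 x : 0 <= nrm x. Proof. exact: sqrtr_ge0. Qed.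

Lemma sqr_hnorm x : nrm x ^+ 2 = ip x x.
Proof. by rewrite sqr_sqrtr ?(ip_ge0 HV). Qed.

Lemma hnormZ a x : nrm (a *: x) = `|a| * nrm x.
Proof. by rewrite /hnorm !ipE mulrA -expr2 sqrtrM ?sqr_ge0// sqrtr_sqr. Qed.

Lemma hnormN x : nrm (- x) = nrm x.
Proof. by rewrite -scaleN1r hnormZ normrN1 mul1r. Qed.

Lemma hnormBC x y : nrm (x - y) = nrm (y - x).
Proof. by rewrite -hnormN opprB. Qed.

Lemma hnorm0 : nrm 0 = 0. Proof. by rewrite /hnorm ip0l sqrtr0. Qed.

Lemma hnorm_eq0 x : nrm x = 0 -> x = 0.
Proof. by move=> x0; apply: (ip_eq0 HV); rewrite -sqr_hnorm x0 expr0n. Qed.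

(** Cauchy-Schwarz: expand the square of [nrm y *: x - nrm x *: y] and divide by
    [2 * (nrm x * nrm y)], which is why zero vectors are treated apart. *)
Lemma ip_le_hnorm x y : ip x y <= nrm x * nrm y.
Proof.
have [x0|x0] := eqVneq (nrm x) 0; first by rewrite (hnorm_eq0 x0) ip0l hnorm0 mul0r.
have [y0|y0] := eqVneq (nrm y) 0; first by rewrite (hnorm_eq0 y0) ip0r hnorm0 mulr0.
have xp : 0 < nrm x by rewrite lt_neqAle eq_sym x0 hnorm_ge0.
have yp : 0 < nrm y by rewrite lt_neqAle eq_sym y0 hnorm_ge0.
have := ip_ge0 HV (nrm y *: x - nrm x *: y).
rewrite !ipE -!sqr_hnorm (ipC y x) => h.
have {h} : 0 <= 2 * (nrm x * nrm y) * (nrm x * nrm y - ip x y) by lra.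
by rewrite pmulr_rge0 ?subr_ge0// !mulr_gt0.
Qed.

Lemma ipN_le_hnorm x y : - ip x y <= nrm x * nrm y.
Proof. by rewrite -ipNl -(hnormN x) ip_le_hnorm. Qed.

Lemma ler_hnormD x y : nrm (x + y) <= nrm x + nrm y.
Proof.
rewrite -(@ler_pXn2r _ 2)// ?nnegrE ?addr_ge0 ?hnorm_ge0//.
rewrite sqr_hnorm !ipE -!sqr_hnorm (ipC y x).
have := ip_le_hnorm x y; nra.
Qed.

Lemma ler_hnormB x y : nrm (x - y) <= nrm x + nrm y.
Proof. by rewrite -(hnormN y) ler_hnormD. Qed.

Lemma ler_hdist z x y : nrm (x - y) <= nrm (x - z) + nrm (z - y).
Proof. by rewrite -{1}(subrK z x) -addrA ler_hnormD. Qed.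

Lemma ler_hnorm_sqr x a : 0 <= a -> (nrm x <= a) = (ip x x <= a ^+ 2).
Proof. by move=> a0; rewrite -sqr_hnorm ler_pXn2r// nnegrE ?hnorm_ge0. Qed.

End Geometry.

(** * Passing to the limit in real inequalities *)

Section Archimedean.
Variable R : realType.

Lemma exists_invS_le (e : R) : 0 < e -> exists N, forall n, (N <= n)%N -> n.+1%:R^-1 <= e :> R.
Proof.
move=> e0; exists (Num.trunc e^-1) => n Nn.
rewrite -(invrK e) lef_pV2 ?posrE ?invr_gt0 ?ltr0n//.
apply/ltW/(lt_le_trans (truncnS_gt _)); by rewrite ler_nat.
Qed.

(** The restriction [e <= 1] lets errors quadratic in [e] be absorbed into [c * e], and lets [e]
    serve as the weight of a convex combination. *)
Lemma le_of_le_addeps (a b c : R) : 0 <= c ->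
  (forall e : R, 0 < e <= 1 -> a <= b + c * e) -> a <= b.
Proof.
move=> c0 H; apply/ler_addgt0Pr => e e0.
have d0 : 0 < Num.min 1 (e / (c + 1)) by rewrite lt_min ltr01 divr_gt0// ltr_wpDl.
apply: le_trans (H (Num.min 1 (e / (c + 1))) _) _; first by rewrite d0 ge_min lexx.
rewrite lerD2l; apply: le_trans (_ : (c+1) * (e / (c+1)) <= e).
  apply: ler_pM => //; first exact: ltW.
    by rewrite lerDl.
  by rewrite ge_min lexx orbT.
by rewrite mulrC divfK// gt_eqF// ltr_wpDl.
Qed.

End Archimedean.

(** * Minimization of strongly convex functions *)

Section Minimization.
Variables (R : realType) (V : lmodType R) (ip : V -> V -> R).
Hypothesis HV : is_hilbert ip.
Local Notation nrm := (hnorm ip).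

(* [E] is the epigraph of a strongly midpoint-convex function, not assumed
   lower semicontinuous: [p] need not be in its domain. *)
Lemma strongly_convex_min (E : V -> R -> Prop) (b kappa : R) :
  0 < kappa -> (exists q t, E q t) -> (forall q t, E q t -> b <= t) ->
  (forall p q s t, E p s -> E q t ->
     E (2^-1 *: (p + q)) ((s + t) / 2 - kappa * ip (p - q) (p - q))) ->
  exists (p : V) (m : R), (forall q t, E q t -> m <= t) /\
    forall e : R, 0 < e -> exists q t, E q t /\ t <= m + e /\ nrm (q - p) <= e.
Proof.
move=> k0 [q0 [t0 E0]] Eb Emid.
pose A : set R := fun t => exists q, E q t.
have Ainf : has_inf A.
  split; first by exists t0; exists q0.
  by exists b => t [q Eqt]; exact: Eb Eqt.
have mlb q t : E q t -> inf A <= t.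
  by move=> Eqt; apply: (ge_inf Ainf.2); exists q.
have /choice[u Hu] : forall n : nat, exists qt : V * R,
    E qt.1 qt.2 /\ qt.2 <= inf A + (n.+1%:R^-1 : R).
  move=> n; have n0 : 0 < (n.+1%:R^-1 : R) by rewrite invr_gt0 ltr0n.
  have [t [q Eqt] tlt] := inf_adherent n0 Ainf.
  by exists (q, t); split => //=; exact: ltW.
have [l Hl] : exists l, forall e : R, 0 < e -> exists N : nat, forall n : nat,
        (N <= n)%N -> nrm ((u n).1 - l) < e.
  apply: (ip_complete HV) => e e0.
  (* A midpoint of two almost minimal points has value at least [inf A], so [kappa] times their
     squared distance is at most the average of their excesses. *)
  have [N HN] := @exists_invS_le R (kappa * (e / 2) ^+ 2)
    ltac:(by rewrite mulr_gt0// exprn_gt0// divr_gt0).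
  exists N => i j Ni Nj.
  have [Ei ti] := Hu i; have [Ej tj] := Hu j.
  have := mlb _ _ (Emid _ _ _ _ Ei Ej).
  have := HN _ Ni; have := HN _ Nj => Hj Hi Hm.
  apply: (@le_lt_trans _ _ (e / 2)); last by lra.
  rewrite ler_hnorm_sqr//; last by lra.
  rewrite -(ler_pM2l k0); move: Hm Hi Hj ti tj.
  set I := ip _ _; set K := kappa * _ ^+ 2; set ri := i.+1%:R^-1; set rj := j.+1%:R^-1; lra.
exists l, (inf A); split => // e e0.
have [N1 HN1] := Hl e e0.
have [N2 HN2] := exists_invS_le e0.
have [E1 t1] := Hu (maxn N1 N2).
exists (u (maxn N1 N2)).1, (u (maxn N1 N2)).2; split => //; split.
  by apply: le_trans t1 _; rewrite lerD2l HN2// leq_maxr.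
by apply/ltW/HN1; rewrite leq_maxl.
Qed.

End Minimization.

(** * Minty's theorem and existence of resolvents *)

Section Minty.
Variables (R : realType) (V : lmodType R) (ip : V -> V -> R).
Hypothesis HV : is_hilbert ip.
Local Notation nrm := (hnorm ip).
Local Notation ipE := (ipE HV).
Implicit Types (x y z u v : V) (B : V -> V -> Prop).

Definition ip_prod (a b : V * V) : R := ip a.1 b.1 + ip a.2 b.2.

Lemma hnorm_fst_le (w : V * V) : nrm w.1 <= hnorm ip_prod w.
Proof. by rewrite ler_sqrt ?addr_ge0 ?(ip_ge0 HV)// lerDl (ip_ge0 HV). Qed.

Lemma hnorm_snd_le (w : V * V) : nrm w.2 <= hnorm ip_prod w.
Proof. by rewrite ler_sqrt ?addr_ge0 ?(ip_ge0 HV)// lerDr (ip_ge0 HV). Qed.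

Lemma hnorm_prod_le (w : V * V) : hnorm ip_prod w <= nrm w.1 + nrm w.2.
Proof.
rewrite -(@ler_pXn2r _ 2)// ?nnegrE ?addr_ge0 ?hnorm_ge0//.
rewrite sqr_sqrtr ?addr_ge0 ?(ip_ge0 HV)// /ip_prod -!(sqr_hnorm HV).
have := hnorm_ge0 ip w.1; have := hnorm_ge0 ip w.2; nra.
Qed.

Lemma is_hilbert_prod : is_hilbert ip_prod.
Proof.
split.
- by move=> a b; rewrite /ip_prod !(ipC HV a.1) !(ipC HV a.2).
- by move=> c a b d; rewrite /ip_prod /= !ipE; ring.
- by move=> a; rewrite addr_ge0 ?(ip_ge0 HV).
- move=> [a b] /eqP; rewrite /ip_prod/= paddr_eq0 ?(ip_ge0 HV)//.
  by case/andP => /eqP/(ip_eq0 HV)-> /eqP/(ip_eq0 HV)->.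
- move=> u cu.
  have [a Ha] : exists l, forall e : R, 0 < e -> exists N : nat, forall n : nat,
        (N <= n)%N -> nrm ((u n).1 - l) < e.
    apply: (ip_complete HV) => e /cu[N HN]; exists N => m n Nm Nn.
    exact: le_lt_trans (hnorm_fst_le (u m - u n)) (HN _ _ Nm Nn).
  have [b Hb] : exists l, forall e : R, 0 < e -> exists N : nat, forall n : nat,
        (N <= n)%N -> nrm ((u n).2 - l) < e.
    apply: (ip_complete HV) => e /cu[N HN]; exists N => m n Nm Nn.
    exact: le_lt_trans (hnorm_snd_le (u m - u n)) (HN _ _ Nm Nn).
  exists (a, b) => e e0.
  have e20 : 0 < e / 2 by rewrite divr_gt0.
  have [Na HNa] := Ha _ e20; have [Nb HNb] := Hb _ e20.
  exists (maxn Na Nb) => n; rewrite geq_max => /andP[/HNa an /HNb bn].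
  by apply: le_lt_trans (hnorm_prod_le _) _ => /=; rewrite [e]splitr ltrD.
Qed.

(** If [s < ip x u], the bound makes [ip (x - y) (u - v)] positive on the whole graph, so maximality
    puts [(x, u)] in the graph; the bound at this very point then reads [ip x u <= s]. *)
Lemma fitzpatrick_ge B x u s : h_max_monotone ip B ->
  (forall y v, B y v -> ip x v + ip y u - ip y v <= s) -> ip x u <= s.
Proof.
move=> [_ Bmax] H; rewrite leNgt; apply/negP => lts.
have /H : B x u.
  apply: Bmax => y v /H; rewrite !ipE; lra.
lra.
Qed.

(* The minimizer [(p1, p2)] of the Fitzpatrick function of [B] plus half the
   squared norm satisfies [|p1 + p2|^2 <= <y + p2, v + p1>] on the graph of
   [B], hence [B (- p2) (- p1)] by maximality, and then [p2 = - p1]. *)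
Lemma minty0 B : h_max_monotone ip B -> exists x, B x (- x).
Proof.
move=> HB; have [Bmon Bmax] := HB.
have [y0 [v0 B0]] : exists y0 v0, B y0 v0.
  apply: contrapT => nB; apply: (nB); exists 0, 0; apply: Bmax => y v Byv.
  by case: nB; exists y, v.
(* [E] is the epigraph of the supremum of the functions [f y v] over the graph, written so that no
   supremum has to be formed. *)
pose f y v (w : V * V) :=
  ip w.1 v + ip y w.2 - ip y v + (ip w.1 w.1 + ip w.2 w.2) / 2.
pose E w t := forall y v, B y v -> f y v w <= t.
have Eself y v : B y v -> E (y, v) (ip y v + (ip y y + ip v v) / 2).
  move=> Byv y' v' Byv'; have := Bmon _ _ _ _ Byv Byv'.
  by rewrite /f/= !ipE; lra.
have Efitz w t : E w t -> ip w.1 w.2 <= t - (ip w.1 w.1 + ip w.2 w.2) / 2.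
  move=> Ewt; apply: (fitzpatrick_ge HB) => y v /Ewt; rewrite /f; lra.
(* The lower bound [0] holds because [Efitz] leaves half the square of [w.1 + w.2]; [8^-1] is the
   midpoint modulus of half the squared norm. *)
have [||w t /Efitz||p [m [pmin papp]]] :=
  @strongly_convex_min _ _ _ is_hilbert_prod E 0 8^-1.
- by rewrite invr_gt0.
- by exists (y0, v0); eexists; exact: Eself.
- have := ip_ge0 HV (w.1 + w.2); rewrite !ipE (ipC HV w.2); lra.
- move=> w w' s t Ew Ew' y v Byv.
  have := Ew _ _ Byv; have := Ew' _ _ Byv.
  rewrite /f /ip_prod /= !ipE !(ipC HV w'.1 w.1) !(ipC HV w'.2 w.2); lra.
(* A supremum of continuous functions has a closed epigraph, so the limit [p] of almost minimal
   points is a true minimizer. *)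
have Ep : E p m.
  move=> y v Byv.
  apply: (@le_of_le_addeps _ _ _ (nrm v + nrm y + nrm p.1 + nrm p.2 + 1)).
    by rewrite !addr_ge0 ?hnorm_ge0.
  move=> e /andP[e0 _]; have [q [t [Eq [tm qp]]]] := papp e e0.
  have := Eq _ _ Byv.
  have q1 : nrm (p.1 - q.1) <= e.
    by rewrite hnormBC//; apply: le_trans (hnorm_fst_le (q - p)) qp.
  have q2 : nrm (p.2 - q.2) <= e.
    by rewrite hnormBC//; apply: le_trans (hnorm_snd_le (q - p)) qp.
  have D1 : ip (p.1 - q.1) v <= e * nrm v.
    by apply: le_trans (ip_le_hnorm HV _ _) _; rewrite ler_wpM2r ?hnorm_ge0.
  have D2 : ip (p.2 - q.2) y <= e * nrm y.
    by apply: le_trans (ip_le_hnorm HV _ _) _; rewrite ler_wpM2r ?hnorm_ge0.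
  have D3 : ip (p.1 - q.1) p.1 <= e * nrm p.1.
    by apply: le_trans (ip_le_hnorm HV _ _) _; rewrite ler_wpM2r ?hnorm_ge0.
  have D4 : ip (p.2 - q.2) p.2 <= e * nrm p.2.
    by apply: le_trans (ip_le_hnorm HV _ _) _; rewrite ler_wpM2r ?hnorm_ge0.
  have := ip_ge0 HV (p.1 - q.1); have := ip_ge0 HV (p.2 - q.2).
  move: D1 D2 D3 D4.
  rewrite /f !ipE (ipC HV q.1 p.1) (ipC HV q.2 p.2) (ipC HV p.2 y) (ipC HV q.2 y).
  lra.
have key y v : B y v -> ip (p.1 + p.2) (p.1 + p.2) <= ip (y + p.2) (v + p.1).
  move=> Byv.
  pose g : V * V := (y - p.1, v - p.2).
  pose G := (ip g.1 g.1 + ip g.2 g.2) / 2.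
  have G0 : 0 <= G by rewrite divr_ge0// addr_ge0 ?(ip_ge0 HV).
  (* Strong convexity on the segment from [p] to [(y, v)]: compare [m] with the value at
     [p + s *: g], divide by [s] and let [s] tend to 0. *)
  have H : m + G <= ip y v + (ip y y + ip v v) / 2.
    apply: (@le_of_le_addeps _ _ _ G) => // s /andP[s0 s1].
    have /pmin : E (p + s *: g) ((1 - s) * m + s * (ip y v + (ip y y + ip v v) / 2)
        - s * (1 - s) * G).
      move=> y' v' B'.
      have h1 : 0 <= (1 - s) * (m - f y' v' p).
        by rewrite mulr_ge0 ?subr_ge0// Ep.
      have h2 : 0 <= s * (ip y v + (ip y y + ip v v) / 2 - f y' v' (y, v)).
        by apply: mulr_ge0; [exact: ltW | rewrite subr_ge0 (Eself y v)].
      rewrite -subr_ge0; apply: le_trans (addr_ge0 h1 h2) _.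
      rewrite le_eqVlt; apply/orP; left; apply/eqP.
      rewrite /G /f /= !ipE (ipC HV y p.1) (ipC HV v p.2); by field.
    by move=> h; rewrite -(ler_pM2l s0); lra.
  have := Efitz _ _ Ep.
  move: H; rewrite /G /= !ipE (ipC HV y p.1) (ipC HV v p.2) (ipC HV p.2 p.1).
  lra.
have Bp : B (- p.2) (- p.1).
  apply: Bmax => y v /key Hyv.
  rewrite -(opprD p.2) -(opprD p.1) !ipE; move: Hyv; rewrite !ipE.
  have := ip_ge0 HV (p.1 + p.2); rewrite !ipE.
  rewrite (ipC HV p.2 p.1); lra.
have := key _ _ Bp; rewrite !addNr ip0l// => p0.
have : p.1 + p.2 = 0 by apply: (ip_eq0 HV); apply/eqP; rewrite eq_le p0 (ip_ge0 HV).
move=> /eqP; rewrite addrC addr_eq0 => /eqP p21.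
by exists p.1; move: Bp; rewrite p21 opprK.
Qed.

(** Minty's theorem applied to [B] scaled by [a] and translated by [- z]: the pair [(x, - x)] is
    then the resolvent inclusion at [x]. *)
Lemma ex_resolvent B (a : R) z : h_max_monotone ip B -> 0 < a ->
  exists p, is_resolvent B a z p.
Proof.
move=> [Bmon Bmax] a0.
have [|x] := @minty0 (fun x u => B x (a^-1 *: (z + u))).
  split => [x u y v Bx By|x u H].
    have := Bmon _ _ _ _ Bx By.
    rewrite -scalerBr opprD addrACA subrr add0r (ipZr HV).
    by rewrite pmulr_rge0 ?invr_gt0.
  apply: Bmax => y v Byv.
  have /H : B y (a^-1 *: (z + (a *: v - z))).
    by rewrite addrC subrK scalerA mulVf ?gt_eqF// scale1r.
  move=> H'; suff -> : a^-1 *: (z + u) - v = a^-1 *: (u - (a *: v - z)).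
    by rewrite (ipZr HV) mulr_ge0// invr_ge0 ltW.
  by rewrite opprB addrA (addrC u) scalerBr scalerA mulVf ?gt_eqF// scale1r.
by move=> Bx; exists x.
Qed.

End Minty.

(** * Maximal monotonicity of the sum; substitutes for weak cluster points *)

Section Operators.
Variables (R : realType) (V : lmodType R) (ip : V -> V -> R).
Hypothesis HV : is_hilbert ip.
Local Notation nrm := (hnorm ip).
Local Notation ipE := (ipE HV).
Implicit Types (x y z u v w : V) (A T : V -> V) (B : V -> V -> Prop).

(** Cut the segment from [x] to [y] into pieces of length at most [d / 2]: [T] moves by at most 1
    over each, and their number is affine in [nrm (x - y)]. *)
Lemma unif_cont_affine_growth T : h_unif_cont ip T ->
  exists C : R, 0 < C /\ forall x y, nrm (T x - T y) <= C * (1 + nrm (x - y)).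
Proof.
move=> /(_ 1 ltr01)[d [d0 Hd]].
have step n x y : nrm (x - y) <= n%:R * (d / 2) -> nrm (T x - T y) <= n%:R.
  elim: n x y => [|n IH] x y xy.
    have xy0 : nrm (x - y) = 0.
      by apply/eqP; rewrite eq_le hnorm_ge0 andbT (le_trans xy)// mul0r.
    by move/(hnorm_eq0 HV)/eqP: xy0; rewrite subr_eq0 => /eqP->; rewrite subrr hnorm0.
  pose t : R := n.+1%:R^-1.
  have n0 : (n.+1%:R : R) != 0 by rewrite pnatr_eq0.
  have t0 : 0 < t by rewrite invr_gt0 ltr0n.
  have nt : n%:R * t = 1 - t.
    by apply: (mulIf n0); rewrite -mulrA mulrBl mulVf// mulr1 mul1r -natr1 addrK.
  pose z := x - t *: (x - y).
  have xz : nrm (x - z) <= d / 2.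
    rewrite opprB addrC subrK (hnormZ HV) gtr0_norm//.
    by rewrite -(ler_pM2l (_ : 0 < n.+1%:R :> R)) ?ltr0n// mulrA mulfV// mul1r.
  have zy : nrm (z - y) <= n%:R * (d / 2).
    have -> : z - y = (n%:R * t) *: (x - y).
      by rewrite nt scalerBl scale1r addrAC.
    rewrite (hnormZ HV) ger0_norm; last by rewrite mulr_ge0// ltW.
    rewrite -mulrA ler_wpM2l//.
    by rewrite -(ler_pM2l (_ : 0 < n.+1%:R :> R)) ?ltr0n// mulrA mulfV// mul1r.
  apply: le_trans (ler_hdist HV (T z) _ _) _.
  rewrite -natr1 addrC lerD ?IH//; apply/ltW/Hd.
  by apply: le_lt_trans xz _; lra.
exists (1 + 2 / d); split; first by rewrite addr_gt0 ?divr_gt0.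
move=> x y; have r0 := hnorm_ge0 ip (x - y).
set r := nrm (x - y) in r0 *.
have s0 : 0 <= 2 / d * r by rewrite mulr_ge0 ?divr_ge0// ltW.
have /andP[lo hi] := truncn_itv s0.
apply: le_trans (step (Num.trunc (2 / d * r)).+1 _ _ _) _.
  rewrite -/r; apply: le_trans (_ : (2 / d * r) * (d / 2) <= _).
    by rewrite le_eqVlt; apply/orP; left; apply/eqP; field; rewrite gt_eqF.
  by rewrite ler_wpM2r ?divr_ge0 ?ltW.
rewrite -natr1; have : 0 <= 2 / d by rewrite divr_ge0 ?ltW.
by move: lo; set D := 2 / d; nra.
Qed.

(** Cauchy-Schwarz turns cocoercivity into a Lipschitz bound with constant [beta^-1]. *)
Lemma cocoercive_unif_cont (beta : R) T :
  0 < beta -> cocoercive ip beta T -> h_unif_cont ip T.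
Proof.
move=> b0 HT e e0; exists (beta * e); split; first exact: mulr_gt0.
move=> x y xy; have := le_trans (HT x y) (ip_le_hnorm HV _ _).
rewrite -(sqr_hnorm HV); have := hnorm_ge0 ip (T x - T y).
set r := nrm (T x - T y); rewrite le_eqVlt => /orP[/eqP<-//|r0].
rewrite expr2 mulrCA ler_pM2l// => h.
by rewrite -(ltr_pM2l b0); apply: le_lt_trans h xy.
Qed.

Lemma cocoercive_monotone (beta : R) T : 0 < beta -> cocoercive ip beta T ->
  forall x y, 0 <= ip (x - y) (T x - T y).
Proof.
move=> b0 HT x y; rewrite (ipC HV); apply: le_trans (HT x y).
by rewrite mulr_ge0 ?(ip_ge0 HV)// ltW.
Qed.

Lemma unif_contD T A : h_unif_cont ip T -> h_unif_cont ip A ->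
  h_unif_cont ip (fun x => T x + A x).
Proof.
move=> HT HA e e0; have e20 : 0 < e / 2 by rewrite divr_gt0.
have [d1 [d10 H1]] := HT _ e20; have [d2 [d20 H2]] := HA _ e20.
exists (Num.min d1 d2); split; first by rewrite lt_min d10.
move=> x y; rewrite lt_min => /andP[/H1 h1 /H2 h2].
by rewrite opprD addrACA (le_lt_trans (ler_hnormD HV _ _))// [e]splitr ltrD.
Qed.

(** The monotonicity inequality passes to strong limits, and maximality puts the limit in the
    graph. *)
Lemma max_monotone_closed B z w : h_max_monotone ip B ->
  (forall e : R, 0 < e <= 1 ->
     exists x u, B x u /\ nrm (x - z) <= e /\ nrm (u - w) <= e) -> B z w.
Proof.
move=> [Bmon Bmax] H; apply: Bmax => y v Byv.
apply: (@le_of_le_addeps _ _ _ (nrm (w - v) + nrm (z - y) + 1)).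
  by rewrite !addr_ge0 ?hnorm_ge0.
move=> e e01; have [x [u [Bxu [xz uw]]]] := H _ e01.
case/andP: e01 => e0 e1.
have := Bmon _ _ _ _ Bxu Byv.
have -> : ip (x - y) (u - v) = ip (z - y) (w - v) + ip (x - z) (w - v)
    + ip (z - y) (u - w) + ip (x - z) (u - w) by rewrite !ipE; ring.
have D1 : ip (x - z) (w - v) <= e * nrm (w - v).
  by apply: le_trans (ip_le_hnorm HV _ _) _; rewrite ler_wpM2r ?hnorm_ge0.
have D2 : ip (z - y) (u - w) <= nrm (z - y) * e.
  by apply: le_trans (ip_le_hnorm HV _ _) _; rewrite ler_wpM2l ?hnorm_ge0.
have D3 : ip (x - z) (u - w) <= e * 1.
  apply: le_trans (ip_le_hnorm HV _ _) _; apply: ler_pM; rewrite ?hnorm_ge0//.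
  exact: le_trans uw e1.
lra.
Qed.

Definition sum_rel A B : V -> V -> Prop := fun x w => B x (w - A x).

(** If [(z, w)] is monotonically related to the sum, resolvents of [B] taken from
    [z - s *: (A z - w)] with small [s] give graph points of [B] close to [(z, w - A z)]; closedness
    of the graph concludes. *)
Lemma max_monotone_sum A B : h_unif_cont ip A ->
  (forall x y, 0 <= ip (x - y) (A x - A y)) ->
  h_max_monotone ip B -> h_max_monotone ip (sum_rel A B).
Proof.
move=> Auc Amon HB; split=> [x u y v Bx By|z w H].
  have := addr_ge0 (HB.1 _ _ _ _ Bx By) (Amon x y).
  by rewrite !ipE; lra.
apply: (max_monotone_closed HB) => e /andP[e0 e1].
have [C [C0 HC]] := unif_cont_affine_growth Auc.
have [d [d0 Hd]] := Auc _ e0.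
pose r : R := Num.min e (d / 2).
have r0 : 0 < r by rewrite lt_min e0 divr_gt0.
have re : r <= e by rewrite ge_min lexx.
have rd : r <= d / 2 by rewrite ge_min lexx orbT.
(* With [s * C = r / 2], affine growth gives [n <= r / 2 * (1 + n)] for [n = nrm (z - p)], hence
   [n <= r] as [r <= 1]. *)
pose s := r / (2 * C).
have s0 : 0 < s by rewrite divr_gt0// mulr_gt0.
have [p Hp] := ex_resolvent HV (z - s *: (A z - w)) HB s0.
rewrite /is_resolvent in Hp; set v := s^-1 *: _ in Hp.
have vE : v = s^-1 *: (z - p) - (A z - w).
  by rewrite /v addrAC scalerBr scalerA mulVf ?gt_eqF// scale1r.
have zp : s^-1 * ip (z - p) (z - p) <= ip (z - p) (A z - A p).
  have := H p (v + A p); rewrite /sum_rel addrK => /(_ Hp).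
  by rewrite vE !ipE; lra.
have zp' : nrm (z - p) <= s * nrm (A z - A p).
  move: zp => /le_trans/(_ (ip_le_hnorm HV _ _)).
  rewrite -(sqr_hnorm HV); have := hnorm_ge0 ip (z - p).
  rewrite le_eqVlt => /orP[/eqP<- _|q0]; first by rewrite mulr_ge0 ?hnorm_ge0// ltW.
  by rewrite expr2 mulrCA ler_pM2l// ler_pdivrMl.
have zpr : nrm (z - p) <= r.
  have : s * C * 2 = r by rewrite /s; field; rewrite gt_eqF.
  have := HC z p; have := hnorm_ge0 ip (z - p).
  move: zp'; set n := nrm (z - p); set m := nrm _ => h1 n0 h2 h3.
  have : n <= s * (C * (1 + n)) by apply: le_trans h1 _; rewrite ler_pM2l.
  have : r <= 1 := le_trans re e1.
  nra.
exists p, v; split=> //; split; first by rewrite hnormBC//; apply: le_trans zpr re.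
rewrite vE -[w - A z]opprB opprK subrK.
rewrite (hnormZ HV) gtr0_norm ?invr_gt0// ler_pdivrMl//.
apply: le_trans zp' _; rewrite ler_pM2l//; apply/ltW/Hd.
by apply: le_lt_trans zpr _; apply: le_lt_trans rd _; lra.
Qed.

(* [q] lies in the closed convex hull of every tail of [u]. *)
Definition tail_hull (u : nat -> V) (q : V) : Prop :=
  forall y c, (exists N, forall k, (N <= k)%N -> c <= ip (u k) y) -> c <= ip q y.

(* Tail hull points replace weak cluster points; one is given by the
   asymptotic center, the minimizer of [q |-> limsup |u k - q|^2]. *)
Lemma ex_tail_hull_point (u : nat -> V) (M : R) :
  (forall k, ip (u k) (u k) <= M) ->
  exists q, tail_hull u q.
Proof.
move=> uM.
pose E q t := exists N, forall k, (N <= k)%N -> ip (u k - q) (u k - q) <= t.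
have [|||p q s t [N HN] [N' HN']|p [m [pmin papp]]] :=
  @strongly_convex_min _ _ _ HV E 0 4^-1.
- by rewrite invr_gt0.
- by exists 0, M, 0%N => k _; rewrite subr0.
- by move=> q t [N HN]; apply: le_trans (HN N _); rewrite ?(ip_ge0 HV).
- exists (maxn N N') => k; rewrite geq_max => /andP[/HN h /HN' h'].
  move: h h'; rewrite !ipE !(ipC HV (u k)) (ipC HV q p); lra.
exists p => y c [N HN].
(* Moving the center by [s *: y] lowers the asymptotic squared radius by at least
   [2 * s * (c - ip p y) - s ^+ 2 * ip y y]; minimality forbids a positive gain. *)
have key s : 0 < s -> 2 * s * (c - ip p y) <= s ^+ 2 * ip y y.
  move=> s0; apply: (@le_of_le_addeps _ _ _ (1 + 2 * s * nrm y)).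
    by rewrite addr_ge0// !mulr_ge0 ?hnorm_ge0// ltW.
  move=> e /andP[e0 _]; have [q [t [[N' HN'] [tm qp]]]] := papp e e0.
  have /pmin : E (q + s *: y) (t - 2 * s * (c - ip q y) + s ^+ 2 * ip y y).
    exists (maxn N N') => k; rewrite geq_max => /andP[/HN h /HN' h'].
    have : 0 <= 2 * s * (ip (u k) y - c) by rewrite mulr_ge0 ?subr_ge0// mulr_ge0// ltW.
    move: h'; rewrite !ipE !(ipC HV _ (u k)) (ipC HV y q); lra.
  have : s * ip (q - p) y <= s * (e * nrm y).
    rewrite ler_pM2l//; apply: le_trans (ip_le_hnorm HV _ _) _.
    by rewrite ler_wpM2r ?hnorm_ge0.
  rewrite !ipE; lra.
apply: (@le_of_le_addeps _ _ _ (ip y y / 2)); first by rewrite divr_ge0 ?(ip_ge0 HV).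
move=> s /andP[s0 _]; have := key _ s0.
rewrite expr2 (mulrC 2) -!mulrA ler_pM2l//; lra.
Qed.

End Operators.

(** * A single projection step *)

Section Steps.
Variables (R : realType) (V : lmodType R) (ip : V -> V -> R).
Hypothesis HV : is_hilbert ip.
Local Notation nrm := (hnorm ip).
Local Notation ipE := (ipE HV).
Implicit Types (x y z u v w h : V) (A : V -> V) (B : V -> V -> Prop).

(** The explicit point is feasible, so [nrm (x - x') <= t * nrm w]; with the feasibility of [x']
    this forces the squared distance of the two points to be at most 0. *)
Lemma proj_halfspace w b (r : R) x x' :
  is_proj ip (fun y => ip w (y - b) <= r) x x' -> r < ip w (x - b) ->
  exists t : R, 0 < t /\ x' = x - t *: w /\ t * ip w w = ip w (x - b) - r.
Proof.
move=> [Tx' Hmin] g0.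
have w0 : 0 < ip w w.
  rewrite lt_neqAle (ip_ge0 HV) andbT eq_sym; apply/eqP => /(ip_eq0 HV) w0.
  by move: g0 Tx'; rewrite w0 !(ip0l HV) => /lt_le_trans h /h; rewrite ltxx.
pose t := (ip w (x - b) - r) / ip w w.
have t0 : 0 < t by rewrite divr_gt0 ?subr_gt0.
have tE : t * ip w w = ip w (x - b) - r by rewrite divfK ?gt_eqF.
exists t; split=> //; split=> //.
have /Hmin : ip w (x - t *: w - b) <= r by move: tE; rewrite !ipE; lra.
rewrite subKr (ler_hnorm_sqr HV) ?hnorm_ge0// (sqr_hnorm HV) => Hx'.
have H2 : 0 <= t * (r - ip w (x' - b)) by rewrite mulr_ge0 ?subr_ge0// ltW.
have tE2 : t * (t * ip w w) = t * (ip w (x - b) - r) by rewrite tE.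
apply/eqP; rewrite eq_sym -subr_eq0; apply/eqP/(ip_eq0 HV)/eqP.
rewrite eq_le (ip_ge0 HV) andbT; move: H2 tE2 Hx'.
rewrite !ipE (ipC HV w x) (ipC HV w x') (ipC HV x' x) (ipC HV w b); lra.
Qed.

(** In use, [X = x - y] and [h = x - p], so [X - h + t *: om] is [p - y'], and the last hypothesis
    is monotonicity up to the slack [r]. *)
Lemma halfspace_step_le X h w om (t r : R) : 0 <= t ->
  t * ip w w = ip w h - r -> - r <= ip (X - h + t *: om) (w - om) ->
  ip (X - t *: (w - om)) (X - t *: (w - om)) <=
    ip X X - ip (t *: w) (t *: w) + 2 * t * ip om h - t ^+ 2 * ip om om.
Proof.
move=> t0 tE H.
have H1 : 0 <= t * (ip (X - h + t *: om) (w - om) + r).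
  by rewrite mulr_ge0// -[r]opprK subr_ge0.
have : t * (t * ip w w) = t * (ip w h - r) by rewrite tE.
move: H1; rewrite !ipE (ipC HV om X) (ipC HV w X) (ipC HV w h) (ipC HV om h) (ipC HV w om).
lra.
Qed.

(** Split [p - y] as [(x - y) - (x - p)], use cocoercivity on the first part and complete the
    square; the loss is [(4 * beta)^-1] times the square of [x - p]. *)
Lemma cocoercive_ge (beta kap : R) A x p y : 0 < beta -> 1 <= 4 * beta * kap ->
  cocoercive ip beta A ->
  - (kap * ip (x - p) (x - p)) <= ip (p - y) (A x - A y).
Proof.
move=> b0 bk /(_ x y); move: (A x - A y) => D HD.
have -> : ip (p - y) D = ip D (x - y) - ip D (x - p).
  by rewrite !ipE !(ipC HV _ D); lra.
move: (x - p) => h; move: HD.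
have h1 : 0 <= (4 * beta)^-1 * ip ((2 * beta) *: D - h) ((2 * beta) *: D - h).
  by rewrite mulr_ge0 ?(ip_ge0 HV)// invr_ge0 mulr_ge0// ltW.
have h2 : (4 * beta)^-1 * ip h h <= kap * ip h h.
  rewrite ler_wpM2r ?(ip_ge0 HV)//.
  by rewrite -[_^-1]mulr1 ler_pdivrMl// mulr_gt0.
have -> : beta * ip D D = (4 * beta)^-1 * ip ((2 * beta) *: D - h) ((2 * beta) *: D - h)
    + ip D h - (4 * beta)^-1 * ip h h.
  by rewrite !ipE (ipC HV h D); field; rewrite gt_eqF.
lra.
Qed.

Lemma resolvent_residual A B (a : R) x p : 0 < a ->
  is_resolvent B a (x - a *: A x) p -> sum_rel A B p (a^-1 *: (x - p) - (A x - A p)).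
Proof.
move=> a0; rewrite /is_resolvent /sum_rel => Bp.
suff -> : a^-1 *: (x - p) - (A x - A p) - A p = a^-1 *: (x - a *: A x - p) by [].
by rewrite -addrA -opprD subrK (addrAC x) [RHS]scalerBr scalerA mulVf ?gt_eqF// scale1r.
Qed.

(* The step has the direction of the resolvent step of [A + B] taken from [y];
   for a zero [y = y'] of [A + B], where [om = 0], this is Fejer monotonicity. *)
Lemma method_step A1 A2 B (beta delta dbar a : R) x p x' :
  0 < beta -> cocoercive ip beta A1 ->
  (forall u v, 0 <= ip (u - v) (A2 u - A2 v)) -> h_monotone ip B ->
  0 < 1 - delta - dbar -> 0 < a -> a <= 4 * beta * dbar ->
  is_resolvent B a (x - a *: (A1 x + A2 x)) p -> ls_test ip A2 delta a x p ->
  is_proj ip (Tk ip A2 dbar a x p) x x' -> x' <> x ->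
  exists t : R, 0 < t /\
  [/\ (1 - delta - dbar) * t * ip (x - p) (x - p) <= a * nrm (x' - x) ^+ 2,
      (1 - delta - dbar) * nrm (x - p) ^+ 2 <=
        nrm (x' - x) * (nrm (x - p) + a * nrm (A2 x - A2 p)) &
      forall y y' om, y' = y - t *: om -> sum_rel (fun v => A1 v + A2 v) B y' om ->
        nrm (x' - y') ^+ 2 <= nrm (x - y) ^+ 2 - nrm (x' - x) ^+ 2
          + 2 * t * ip om (x - p) - t ^+ 2 * ip om om].
Proof.
move=> b0 HA1 A2mon Bmon c0 a0 ab Bp ls Px' nstop.
have [w wdef] : exists w, w = a^-1 *: (x - p) - (A2 x - A2 p) by eexists.
have [r rdef] : exists r, r = dbar / a * ip (x - p) (x - p) by eexists.
rewrite /Tk -wdef -rdef in Px'.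
have ia0 : 0 < a^-1 by rewrite invr_gt0.
(* By the linesearch test, [x] violates the half-space inequality by a definite amount. *)
have gap : (1 - delta - dbar) / a * ip (x - p) (x - p) <= ip w (x - p) - r.
  have : a^-1 * (a * ip (A2 x - A2 p) (x - p)) <= a^-1 * (delta * ip (x - p) (x - p)).
    by rewrite ler_pM2l.
  have wE h d : ip (a^-1 *: h - d) h = a^-1 * ip h h - ip d h.
    by rewrite (ipDl HV) (ipNl HV) (ipZl HV).
  rewrite mulKf ?gt_eqF// wdef rdef wE.
  by set I := ip (x - p) (x - p); set J := ip _ _; lra.
have rlt : r < ip w (x - p).
  rewrite ltNge; apply/negP => wr; apply: nstop.
  have := Px'.2 x wr; rewrite subrr hnorm0// => h0.
  have /(hnorm_eq0 HV)/eqP : nrm (x - x') = 0 by apply/eqP; rewrite eq_le h0 hnorm_ge0.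
  by rewrite subr_eq0 => /eqP.
have [t [t0 [x'E tE]]] := proj_halfspace Px' rlt.
have epsE : nrm (x' - x) ^+ 2 = t * (t * ip w w).
  by rewrite x'E addrAC subrr add0r hnormN// (sqr_hnorm HV) !ipE.
exists t; split=> //; split.
- rewrite epsE tE.
  have : a * t * ((1 - delta - dbar) / a * ip (x - p) (x - p)) <=
      a * t * (ip w (x - p) - r) by rewrite ler_pM2l// mulr_gt0.
  have -> : a * t * ((1 - delta - dbar) / a * ip (x - p) (x - p)) =
      (1 - delta - dbar) * t * ip (x - p) (x - p) by field; rewrite gt_eqF.
  by rewrite mulrA.
- have nE : nrm (x' - x) * nrm w = t * ip w w.
    rewrite x'E addrAC subrr add0r hnormN// (hnormZ HV) gtr0_norm//.
    by rewrite -mulrA -expr2 (sqr_hnorm HV).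
  have : a * ((1 - delta - dbar) / a * ip (x - p) (x - p)) <= a * (nrm (x' - x) * nrm w).
    by rewrite ler_pM2l// nE tE.
  have -> : a * ((1 - delta - dbar) / a * ip (x - p) (x - p)) =
      (1 - delta - dbar) * ip (x - p) (x - p) by field; rewrite gt_eqF.
  rewrite (sqr_hnorm HV) => /le_trans; apply.
  rewrite mulrCA ler_wpM2l ?hnorm_ge0//.
  apply: le_trans (_ : a * (a^-1 * nrm (x - p) + nrm (A2 x - A2 p)) <= _).
    rewrite ler_pM2l// wdef; apply: le_trans (ler_hnormB HV _ _) _.
    by rewrite (hnormZ HV) gtr0_norm.
  by rewrite mulrDr mulrA mulfV ?gt_eqF// mul1r.
- move=> y y' om y'E By'.
  (* [w] carries no [A1] term: it is removed from the monotonicity inequality by [cocoercive_ge]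
     with [kap = dbar / a], at the cost of exactly [r]. *)
  have Hr : - r <= ip (p - y') (w - om).
    have h1 := Bmon _ _ _ _ (resolvent_residual (A := fun v => A1 v + A2 v) a0 Bp) By'.
    have h2 := A2mon p y'.
    have h3 : - (dbar / a * ip (x - p) (x - p)) <= ip (p - y') (A1 x - A1 y').
      apply: (cocoercive_ge _ _ _ b0 _ HA1).
      by rewrite mulrA -(ler_pM2r a0) mul1r divfK ?gt_eqF.
    move: h1 h2 h3; rewrite wdef -rdef /= !ipE; lra.
  have -> : x' - y' = (x - y) - t *: (w - om).
    by rewrite x'E y'E (scalerBr t w om) !opprB addrACA [RHS]addrACA (addrC (- (t *: w))).
  rewrite (_ : nrm (x' - x) ^+ 2 = ip (t *: w) (t *: w)); last by rewrite epsE !ipE.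
  rewrite !(sqr_hnorm HV); apply: halfspace_step_le (ltW t0) tE _.
  suff -> : x - y - (x - p) + t *: om = p - y' by [].
  by rewrite y'E !opprB addrC [x - y + _]addrC subrKA addrCA.
Qed.

(** * Fejer monotone sequences and Opial's argument *)

Lemma nonincreasing_tail (F : nat -> R) (e : R) : 0 < e ->
  (forall k, 0 <= F k) -> (forall k, F k.+1 <= F k) ->
  exists K, forall i j, (K <= i)%N -> (K <= j)%N -> F i - F j <= e.
Proof.
move=> e0 F0 Fdec.
have Fle i j : (i <= j)%N -> F j <= F i.
  by move/subnK<-; elim: (j - i)%N => // n; apply: le_trans (Fdec _).
pose A : set R := range F.
have Ainf : has_inf A by split; [exists (F 0%N), 0%N | exists 0 => _ [k _ <-]].
have [_ [K _ <-] FK] := inf_adherent e0 Ainf.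
exists K => i j Ki Kj.
have : inf A <= F j by apply: (ge_inf Ainf.2); exists j.
have := Fle _ _ Ki; lra.
Qed.

(* For two tail hull points [xs], [q] lying in [S], the convergence of
   [|x k - xs|] and [|x k - q|] makes [<x k, q - xs>] converge, to both
   [<xs, q - xs>] and [<q, q - xs>]; hence [q = xs]. *)
Lemma opial (S : V -> Prop) (x : nat -> V) z : S z ->
  (forall z k, S z -> nrm (x k.+1 - z) ^+ 2 <= nrm (x k - z) ^+ 2) ->
  (forall f : nat -> nat, (forall n, (n <= f n)%N) ->
     forall q, tail_hull ip (x \o f) q -> S q) ->
  exists xs, S xs /\ weak_cvg ip x xs.
Proof.
move=> Sz fejer hullS.
have bnd k : ip (x k) (x k) <= (nrm (x 0%N - z) + nrm z) ^+ 2.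
  rewrite -(ler_hnorm_sqr HV) ?addr_ge0 ?hnorm_ge0//.
  rewrite -[in X in X <= _](subrK z (x k)); apply: le_trans (ler_hnormD HV _ _) _.
  rewrite lerD2r -(@ler_pXn2r _ 2)// ?nnegrE ?hnorm_ge0//.
  elim: k => // k IH; exact: le_trans (fejer _ _ Sz) IH.
have [xs hxs] := ex_tail_hull_point HV bnd.
have Sxs : S xs by apply: (hullS id).
exists xs; split=> // y.
apply/cvgrPdist_lt => e e0.
apply: contrapT => nev.
(* If convergence against [y] fails, the deviation has a fixed sign [s] along some [f]; [n <= f n]
   is enough for tails, so [f] is not made increasing. *)
have [s [f [fn fy]]] : exists (s : R) (f : nat -> nat), (forall n, (n <= f n)%N) /\
    forall n, e <= ip (x (f n)) (s *: y) - ip xs (s *: y).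
  have bad N : exists k, (N <= k)%N /\ e <= `|ip xs y - ip (x k) y|.
    apply: contrapT => nb; apply: nev; exists N => // k /= Nk.
    by rewrite ltNge; apply/negP => ek; apply: nb; exists k.
  have [[N HN]|nN] := pselect (exists N, forall k, (N <= k)%N ->
      ~ e <= ip (x k) (1 *: y) - ip xs (1 *: y)).
    have /choice[f Hf] : forall n, exists k, (n <= k)%N /\
        e <= ip (x k) ((-1) *: y) - ip xs ((-1) *: y).
      move=> n; have [k [nk ek]] := bad (maxn n N).
      exists k; split; first by rewrite (leq_trans _ nk)// leq_maxl.
      have /HN : (N <= k)%N by rewrite (leq_trans _ nk)// leq_maxr.
      move: ek; rewrite !ipE; case: ler0P => ? *; lra.
    by exists (-1), f; split=> n; case: (Hf n).
  have /choice[f Hf] : forall n, exists k, (n <= k)%N /\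
        e <= ip (x k) (1 *: y) - ip xs (1 *: y).
    move=> n; apply: contrapT => nk; apply: nN; exists n => k kn ek.
    by apply: nk; exists k.
  by exists 1, f; split=> n; case: (Hf n).
have [q hq] := ex_tail_hull_point (u := x \o f) HV (fun n => bnd (f n)).
have Sq : S q := hullS _ fn _ hq.
have qy : e + ip xs (s *: y) <= ip q (s *: y).
  by apply: hq; exists 0%N => k _ /=; have := fy k; lra.
suff qxs : q = xs by move: qy; rewrite qxs; lra.
apply/eqP; rewrite -subr_eq0; apply/eqP/(ip_eq0 HV)/eqP.
rewrite eq_le (ip_ge0 HV) andbT.
apply: (@le_of_le_addeps _ _ _ 2) => // d /andP[d0 _]; rewrite add0r.
have F0 z' k : 0 <= nrm (x k - z') ^+ 2 by rewrite sqr_ge0.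
have [K1 HK1] := nonincreasing_tail d0 (F0 q) (fun k => fejer _ k Sq).
have [K2 HK2] := nonincreasing_tail d0 (F0 xs) (fun k => fejer _ k Sxs).
pose K := maxn K1 K2.
have near k : (K <= k)%N -> ip (x k) (q - xs) - ip (x K) (q - xs) <= d /\
    ip (x K) (q - xs) - ip (x k) (q - xs) <= d.
  rewrite geq_max => /andP[k1 k2].
  have := HK1 _ _ k1 (leq_maxl K1 K2); have := HK2 _ _ (leq_maxr K1 K2) k2.
  have := HK1 _ _ (leq_maxl K1 K2) k1; have := HK2 _ _ k2 (leq_maxr K1 K2).
  rewrite !(sqr_hnorm HV) !ipE !(ipC HV q) !(ipC HV xs) -/K; split; lra.
have : ip (x K) (q - xs) - d <= ip xs (q - xs).
  by apply: hxs; exists K => k /near[]; lra.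
have : - (ip (x K) (q - xs) + d) <= ip q (- (q - xs)).
  apply: hq; exists K => k Kk /=; have [] := near _ (leq_trans Kk (fn k)).
  by rewrite (ipNr HV); lra.
rewrite !ipE; lra.
Qed.

End Steps.

(** * Asymptotics of the method and weak convergence *)

Section Method.
Variables (R : realType) (V : lmodType R) (ip : V -> V -> R).
Hypothesis HV : is_hilbert ip.
Variables (A1 A2 : V -> V) (B : V -> V -> Prop) (beta : R).
Hypotheses (Hbeta : 0 < beta) (HA1 : cocoercive ip beta A1).
Hypotheses (HA2 : h_max_monotone ip (op_graph A2)) (HA2c : h_unif_cont ip A2).
Hypothesis (HB : h_max_monotone ip B).
Variables (theta delta dbar am1 : R).
Hypotheses (Htheta : 0 < theta < 1) (Hdelta : 0 < delta < 1).
Hypotheses (Hdd : 0 < 1 - delta - dbar).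
Hypotheses (Ham1 : 0 < am1) (Ham1b : am1 <= 4 * beta * dbar).
Variables (x0 : V) (x : nat -> V) (alpha : nat -> R) (xb : nat -> V).
Hypothesis Hmeth : method1 ip A1 A2 B theta delta dbar x0 am1 x alpha xb.
Hypothesis Hnostop : forall k : nat, x k.+1 <> x k.

Local Notation nrm := (hnorm ip).
Local Notation ipE := (ipE HV).
Local Notation A := (fun v => A1 v + A2 v).
Local Notation M := (sum_rel A B).
Local Notation c := (1 - delta - dbar).
Local Notation h k := (x k - xb k).
Local Notation eps k := (nrm (x k.+1 - x k)).
Implicit Types (k : nat) (y z om : V) (eta : R).

Let A2mon u v : 0 <= ip (u - v) (A2 u - A2 v).
Proof. exact: HA2.1. Qed.

Let Amon u v : 0 <= ip (u - v) (A u - A v).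
Proof.
have := addr_ge0 (cocoercive_monotone HV Hbeta HA1 u v) (A2mon u v).
by rewrite !ipE; lra.
Qed.

Let Auc : h_unif_cont ip A.
Proof. exact: unif_contD (cocoercive_unif_cont HV Hbeta HA1) HA2c. Qed.

Let Mmax : h_max_monotone ip M.
Proof. exact: max_monotone_sum. Qed.

Lemma zerE z : zer A B z <-> M z 0.
Proof. by rewrite /zer /sum_rel sub0r. Qed.

Lemma alpha_step k : exists j, alpha k.+1 = alpha k * theta ^+ j.
Proof. by have [_ [_ /(_ k)[[j [aj _]] _]]] := Hmeth; exists j. Qed.

Lemma alpha_gt0 k : 0 < alpha k.
Proof.
have [t0 _] := andP Htheta.
elim: k => [|k IH]; first by have [_ [->]] := Hmeth.
by have [j ->] := alpha_step k; rewrite mulr_gt0// exprn_gt0.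
Qed.

Lemma alpha_noninc i j : (i <= j)%N -> alpha j <= alpha i.
Proof.
have [t0 t1] := andP Htheta.
move/subnK<-; elim: (j - i)%N => // n; apply: le_trans.
rewrite addSn; have [m ->] := alpha_step (n + i).
by rewrite ger_pMr ?alpha_gt0// exprn_ile1// ltW.
Qed.

Lemma alpha_le k : alpha k <= am1.
Proof. by have [_ [<- _]] := Hmeth; exact: alpha_noninc. Qed.

Lemma step k : exists t : R, 0 < t /\
  [/\ c * t * ip (h k) (h k) <= alpha k.+1 * eps k ^+ 2,
      c * nrm (h k) ^+ 2 <=
        eps k * (nrm (h k) + alpha k.+1 * nrm (A2 (x k) - A2 (xb k))) &
      forall y y' om, y' = y - t *: om -> M y' om ->
        nrm (x k.+1 - y') ^+ 2 <= nrm (x k - y) ^+ 2 - eps k ^+ 2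
          + 2 * t * ip om (h k) - t ^+ 2 * ip om om].
Proof.
have [_ [_ /(_ k)[[j [aj [ls _]]] [res proj]]]] := Hmeth.
apply: (method_step HV Hbeta HA1 A2mon HB.1 Hdd (alpha_gt0 _)) proj (@Hnostop k) => //.
  exact: le_trans (alpha_le _) Ham1b.
by rewrite aj; apply: ls; rewrite -aj.
Qed.

Lemma fejer z k : M z 0 ->
  nrm (x k.+1 - z) ^+ 2 <= nrm (x k - z) ^+ 2 - eps k ^+ 2.
Proof.
move=> Mz; have [t [t0 [_ _ /(_ z z 0)]]] := step k.
rewrite scaler0 subr0 !(ip0l HV) !mulr0 subr0 addr0; exact.
Qed.

Lemma fejer_le z k : M z 0 -> nrm (x k.+1 - z) ^+ 2 <= nrm (x k - z) ^+ 2.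
Proof. by move=> /(fejer k); have := sqr_ge0 (eps k); lra. Qed.

Lemma fejer_bound z k : M z 0 -> nrm (x k - z) <= nrm (x 0%N - z).
Proof.
move=> Mz; rewrite -(@ler_pXn2r _ 2)// ?nnegrE ?hnorm_ge0//.
elim: k => // k IH; exact: le_trans (fejer_le _ Mz) IH.
Qed.

Lemma fejer_tail z (e : R) : M z 0 -> 0 < e -> exists K, forall i j,
  (K <= i)%N -> (K <= j)%N -> nrm (x i - z) ^+ 2 - nrm (x j - z) ^+ 2 <= e.
Proof.
move=> Mz e0; apply: (nonincreasing_tail e0) => k; first exact: sqr_ge0.
exact: fejer_le.
Qed.

Lemma eps_cvg0 z (e : R) : M z 0 -> 0 < e ->
  exists K, forall k, (K <= k)%N -> eps k <= e.
Proof.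
move=> Mz e0; have [K HK] := fejer_tail Mz (exprn_gt0 2 e0).
exists K => k Kk; rewrite -(@ler_pXn2r _ 2)// ?nnegrE ?hnorm_ge0//; last exact: ltW.
by have := fejer k Mz; have := HK _ _ Kk (leqW Kk); lra.
Qed.

(** The second bound of [step] with the affine growth of [A2] keeps [eps k] away from 0 whenever
    [nrm (h k)] is. *)
Lemma h_cvg0 z (e : R) : M z 0 -> 0 < e ->
  exists K, forall k, (K <= k)%N -> nrm (h k) <= e.
Proof.
move=> Mz e0; have [C [C0 HC]] := unif_cont_affine_growth HV HA2c.
pose D := e + am1 * C * (1 + e).
have D0 : 0 < D by rewrite addr_gt0// !mulr_gt0// addr_gt0.
have [K HK] := eps_cvg0 Mz (e := c * e ^+ 2 / D) ltac:(by rewrite divr_gt0// mulr_gt0// exprn_gt0).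
exists K => k /HK; rewrite ler_pdivlMr// => He.
rewrite leNgt; apply/negP => eh.
have [t [_ [_ H _]]] := step k.
have d1 : alpha k.+1 * nrm (A2 (x k) - A2 (xb k)) <= am1 * (C * (1 + nrm (h k))).
  by apply: ler_pM; [exact/ltW/alpha_gt0 | exact: hnorm_ge0 | exact: alpha_le |].
have n0 := hnorm_ge0 ip (x k.+1 - x k).
have H2 : c * nrm (h k) ^+ 2 <= eps k * (nrm (h k) + am1 * (C * (1 + nrm (h k)))).
  by apply: le_trans H _; rewrite ler_wpM2l// lerD2l.
(* The ratio of the bracket to [nrm (h k)] decreases in [nrm (h k)], and equals [D / e] when this
   norm is [e]. *)
have H3 : e * (nrm (h k) + am1 * (C * (1 + nrm (h k)))) <= nrm (h k) * D.
  have : 0 <= am1 * C * (nrm (h k) - e).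
    by apply: mulr_ge0; [apply/ltW/mulr_gt0 | rewrite subr_ge0 ltW].
  by rewrite /D; lra.
have H4 : e * (c * nrm (h k) ^+ 2) <= nrm (h k) * (c * e ^+ 2).
  apply: le_trans (_ : eps k * (nrm (h k) * D) <= _).
    apply: le_trans (_ : e * (eps k * (nrm (h k) + am1 * (C * (1 + nrm (h k))))) <= _).
      by rewrite ler_pM2l.
    by rewrite mulrCA ler_wpM2l.
  by rewrite mulrCA ler_wpM2l ?hnorm_ge0.
have h0 : 0 < nrm (h k) by apply: lt_trans eh.
have : 0 < e * c * nrm (h k) * (nrm (h k) - e) by rewrite !mulr_gt0// subr_gt0.
lra.
Qed.

Lemma residual_near (a eta : R) z p : 0 < a ->
  is_resolvent B a (z - a *: A z) p -> nrm (z - p) <= eta * a ->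
  nrm (A z - A p) <= eta -> exists om, M p om /\ nrm om <= 2 * eta.
Proof.
move=> a0 /(resolvent_residual a0) Mp zp Azp; eexists; split; first exact: Mp.
apply: le_trans (ler_hnormB HV _ _) _.
rewrite (hnormZ HV) gtr0_norm ?invr_gt0//.
have : a^-1 * nrm (z - p) <= eta by rewrite ler_pdivrMl// mulrC.
lra.
Qed.

(* When the steps [alpha] get small, some backtracking step is rejected; the
   trial point of the rejected step has a small residual. *)
Lemma ex_rejected_trial (K : nat) (eta : R) : 0 < eta ->
  (forall tau, 0 < tau -> exists k, alpha k < tau) ->
  exists k y om, (K <= k)%N /\ M y om /\ nrm om <= 2 * eta /\ nrm (x k - y) <= eta.
Proof.
move=> eta0 small.
have [t0 t1] := andP Htheta; have [d0 _] := andP Hdelta.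
have [C [C0 HC]] := unif_cont_affine_growth HV HA2c.
have [r1 [r10 Hr1]] := Auc eta0.
have [r2 [r20 Hr2]] := HA2c (mulr_gt0 d0 eta0).
pose s := Num.min (Num.min 1 eta) (Num.min r1 r2) / 3.
have m0 : 0 < Num.min (Num.min 1 eta) (Num.min r1 r2).
  by rewrite !lt_min ltr01 eta0 r10 r20.
have s0 : 0 < s by rewrite divr_gt0.
have [s1 se sr1 sr2] : [/\ 3 * s <= 1, 3 * s <= eta, 3 * s <= r1 & 3 * s <= r2].
  by rewrite /s mulrC divfK//; split; rewrite !ge_min lexx ?orbT.
(* The last rejected trial step is [alpha k.+1 / theta]; with [alpha k.+1 < tau] it satisfies
   [a * C <= delta * s]. *)
pose tau := theta * (delta * s / C).
have tau0 : 0 < tau by rewrite !mulr_gt0// invr_gt0.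
(* At the first such index [n], being below [alpha K] gives [K < n], and minimality shows that the
   stepsize has just dropped, so a trial was rejected. *)
have exm : exists n, alpha n < Num.min tau (alpha K).
  by apply: small; rewrite lt_min tau0 alpha_gt0.
case: (ex_minnP exm) => n; rewrite lt_min => /andP[ntau nK] nmin.
have Kn : (K < n)%N.
  by rewrite ltnNge; apply/negP => /alpha_noninc; rewrite leNgt nK.
case: n => // k in ntau nK nmin Kn *.
have [_ [_ /(_ k)[[j [aj [_ rej]]] _]]] := Hmeth.
case: j => [|i] in aj rej *.
  have := nmin k; rewrite ltnn lt_min; rewrite expr0 mulr1 in aj.
  by rewrite -aj ntau nK => /(_ isT).
pose a := alpha k * theta ^+ i.
have a0 : 0 < a by rewrite mulr_gt0 ?alpha_gt0// exprn_gt0.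
have aC : a * C <= delta * s.
  move: ntau; rewrite aj exprS mulrCA -/a /tau ltr_pM2l// ltr_pdivlMr//; exact: ltW.
have [p Hp] := ex_resolvent HV (x k - a *: A (x k)) HB a0.
have := rej i (ltnSn i) p Hp; rewrite /ls_test -/a => /negP; rewrite -ltNge => rejp.
(* Rejection and Cauchy-Schwarz: the displacement is at most [a / delta] times the variation of
   [A2], which affine growth and then uniform continuity make small. *)
have hp : delta * nrm (x k - p) <= a * nrm (A2 (x k) - A2 p).
  have := le_trans (ltW rejp) (ler_wpM2l (ltW a0) (ip_le_hnorm HV _ _)).
  rewrite -(sqr_hnorm HV) expr2 !mulrA.
  have := hnorm_ge0 ip (x k - p); rewrite le_eqVlt => /orP[/eqP<- _|q0].
    by rewrite mulr0 mulr_ge0 ?hnorm_ge0// ltW.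
  by rewrite ler_pM2r.
have hs : nrm (x k - p) <= 2 * s.
  have : delta * nrm (x k - p) <= delta * (s * (1 + nrm (x k - p))).
    apply: le_trans hp _; apply: le_trans (_ : a * (C * (1 + nrm (x k - p))) <= _).
      by rewrite ler_pM2l.
    by rewrite (mulrA a) (mulrA delta) ler_wpM2r// addr_ge0// hnorm_ge0.
  rewrite ler_pM2l//; have := hnorm_ge0 ip (x k - p).
  set q := nrm _; nra.
have [om [Mp omb]] : exists om, M p om /\ nrm om <= 2 * eta.
  apply: (residual_near a0 Hp).
    rewrite -(ler_pM2l d0); apply: le_trans hp _.
    by rewrite mulrA mulrC ler_pM2r//; apply/ltW/Hr2; lra.
  by apply/ltW/Hr1; lra.
exists k, p, om; split=> //; split=> //; split=> //; lra.
Qed.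

(* Past some index, a pair [(y, om)] of the graph of [A + B] with small [om]
   and [x k] close to [y] is propagated by the resolvent steps
   [y' = J_(t (A + B)) y] while [|h k| / alpha k > eta], and renewed by
   [y' = xb k] otherwise. *)
Lemma near_graph z eta : M z 0 -> 0 < eta -> exists K, forall k, (K <= k)%N ->
  exists y om, M y om /\ nrm om <= 2 * eta /\ nrm (x k - y) <= 3 * eta.
Proof.
move=> Mz eta0.
have [r [r0 Hr]] := Auc eta0.
have r20 : 0 < Num.min (r / 2) eta by rewrite lt_min eta0 divr_gt0.
have [K1 HK1] := h_cvg0 Mz r20.
have [K2 HK2] := eps_cvg0 Mz eta0.
have [K3 HK3] := fejer_tail Mz (mulr_gt0 Hdd (exprn_gt0 2 eta0)).
pose K := maxn K1 (maxn K2 K3).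
pose F k := nrm (x k - z) ^+ 2.
have hK k : (K <= k)%N -> [/\ nrm (h k) < r, nrm (h k) <= eta, eps k <= eta &
    0 <= F K - F k <= c * eta ^+ 2].
  move=> Kk; have := Kk; rewrite !geq_max => /and3P[k1 k2 k3].
  have := HK1 _ k1; rewrite le_min => /andP[hr he].
  split=> //; [lra | exact: HK2 |].
  apply/andP; split; last first.
    by apply: HK3 => //; rewrite /K !leq_max leqnn !orbT.
  rewrite subr_ge0.
  by move: Kk => /subnK<-; elim: (k - K)%N => // n; apply: le_trans (fejer_le _ Mz).
(* The budget: the squared distance starts at [4 * eta ^+ 2] and grows by [4 / c] times the decrease
   of [F], at most [c * eta ^+ 2] after [K]; the total of [8 * eta ^+ 2] is below
   [(3 * eta) ^+ 2]. *)
pose P k := exists y om, M y om /\ nrm om <= 2 * eta /\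
  nrm (x k - y) ^+ 2 <= 4 * eta ^+ 2 + 4 / c * (F K - F k).
have FK0 k : (K <= k)%N -> 0 <= 4 / c * (F K - F k).
  by move=> /hK[_ _ _ /andP[f0 _]]; rewrite mulr_ge0// divr_ge0// ltW.
have low k : (K <= k)%N -> nrm (h k) <= eta * alpha k.+1 -> P k.+1.
  move=> Kk hk; have [hr he ek _] := hK _ Kk.
  have [_ [_ /(_ k)[_ [res _]]]] := Hmeth.
  have [om [Mom omb]] := residual_near (alpha_gt0 _) res hk (ltW (Hr _ _ hr)).
  exists (xb k), om; split=> //; split=> //.
  have : nrm (x k.+1 - xb k) <= 2 * eta.
    by apply: le_trans (ler_hdist HV (x k) _ _) _; lra.
  have := FK0 _ (leqW Kk); have := hnorm_ge0 ip (x k.+1 - xb k).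
  by set q := nrm _; nra.
have high k : (K <= k)%N -> eta * alpha k.+1 < nrm (h k) -> P k -> P k.+1.
  move=> Kk hk [y [om [Mom [omb Hy]]]].
  have [t [t0 [Ht _ Hstep]]] := step k.
  have [y' Hy'] := ex_resolvent HV y Mmax t0.
  rewrite /is_resolvent in Hy'; set om' := t^-1 *: _ in Hy'.
  have om'E : t *: om' = y - y' by rewrite scalerA mulfV ?gt_eqF// scale1r.
  have omle : nrm om' <= nrm om.
    have : 0 <= ip (t *: om') (om - om') by rewrite om'E; exact: Mmax.1 Mom Hy'.
    rewrite (ipZl HV) pmulr_rge0// (ipDr HV) (ipNr HV) subr_ge0 => /le_trans.
    move=> /(_ _ (ip_le_hnorm HV _ _)); rewrite -(sqr_hnorm HV) expr2.
    have := hnorm_ge0 ip om'; rewrite le_eqVlt => /orP[/eqP<- _|q0].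
      exact: hnorm_ge0.
    by rewrite ler_pM2l.
  exists y', om'; split=> //; split; first exact: le_trans omle omb.
  have := Hstep y y' om' _ Hy'; rewrite om'E subKr => /(_ erefl) {}Hstep.
  (* Since [eta < nrm (h k) / alpha k.+1], the error is at most
     [4 * t * nrm (h k) ^+ 2 / alpha k.+1], which the first bound of [step] controls by
     [eps k ^+ 2]. *)
  have H1 : 2 * t * ip om' (h k) <= 4 / c * eps k ^+ 2.
    apply: le_trans (_ : 4 * t * (eta * nrm (h k)) <= _).
      have : ip om' (h k) <= 2 * eta * nrm (h k).
        apply: le_trans (ip_le_hnorm HV _ _) _; rewrite ler_wpM2r ?hnorm_ge0//.
        exact: le_trans omle omb.
      by move=> H; have : 0 <= 2 * t * (2 * eta * nrm (h k) - ip om' (h k));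
        [rewrite mulr_ge0 ?subr_ge0// mulr_ge0// ltW | lra].
    have a0 := alpha_gt0 k.+1.
    rewrite -(ler_pM2l (mulr_gt0 Hdd a0)).
    have -> : c * alpha k.+1 * (4 / c * eps k ^+ 2) = 4 * (alpha k.+1 * eps k ^+ 2).
      by field; rewrite gt_eqF.
    have : 0 <= 4 * c * t * nrm (h k) * (nrm (h k) - eta * alpha k.+1).
      apply: mulr_ge0; last by rewrite subr_ge0 ltW.
      apply: mulr_ge0; last exact: hnorm_ge0.
      by rewrite ltW// !mulr_gt0.
    move: Ht; rewrite -(sqr_hnorm HV); lra.
  have H2 : 4 / c * eps k ^+ 2 <= 4 / c * (F k - F k.+1).
    rewrite ler_wpM2l ?divr_ge0 ?(ltW Hdd)//.
    by have := fejer k Mz; rewrite -/(F k) -/(F k.+1); lra.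
  have : 0 <= t ^+ 2 * ip om' om' by rewrite mulr_ge0 ?sqr_ge0 ?(ip_ge0 HV).
  have := sqr_ge0 (eps k).
  move: Hstep H1 H2 Hy; set Q := 4 / c; lra.
have next k : (K <= k)%N -> P k -> P k.+1.
  by move=> Kk Pk; have [/low|/high] := leP (nrm (h k)) (eta * alpha k.+1); auto.
(* Either a small ratio occurs after [K] and starts the propagation, or
   [eta * alpha k.+1 < nrm (h k)] throughout; then the steps tend to 0 and a rejected trial provides
   the start. *)
have [k0 [Kk0 Pk0]] : exists k0, (K <= k0)%N /\ P k0.
  have [[k [Kk hk]]|nlow] :=
      pselect (exists k, (K <= k)%N /\ nrm (h k) <= eta * alpha k.+1).
    by exists k.+1; split; [exact: leqW | exact: low].
  have [|k [y [om [Kk [Mom [omb xy]]]]]] := @ex_rejected_trial K _ eta0.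
    move=> tau tau0; have [K' HK'] := h_cvg0 Mz (mulr_gt0 eta0 tau0).
    exists (maxn K K').+1; rewrite -(ltr_pM2l eta0).
    apply: lt_le_trans (HK' _ (leq_maxr K K')).
    rewrite ltNge; apply/negP => hk; apply: nlow.
    by exists (maxn K K'); rewrite leq_maxl.
  exists k; split=> //; exists y, om; split=> //; split=> //.
  move: xy (FK0 _ Kk) (hnorm_ge0 ip (x k - y)).
  by set q := nrm _; set X := _ * (F K - _); nra.
exists k0 => k k0k.
have Kk := leq_trans Kk0 k0k.
have [y [om [Mom [omb Hy]]]] : P k.
  move: k0k => /subnK<-; elim: (k - k0)%N => // n IH.
  by apply: next => //; rewrite (leq_trans Kk0)// leq_addl.
exists y, om; split=> //; split=> //.
have [_ _ _ /andP[_ FKk]] := hK _ Kk.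
rewrite -(@ler_pXn2r _ 2)// ?nnegrE ?hnorm_ge0//; last by rewrite mulr_ge0// ltW.
apply: le_trans Hy _.
have : 4 / c * (F K - F k) <= 4 / c * (c * eta ^+ 2).
  by rewrite ler_wpM2l// divr_ge0// ltW.
have -> : 4 / c * (c * eta ^+ 2) = 4 * eta ^+ 2 by field; rewrite gt_eqF.
have := sqr_ge0 eta; lra.
Qed.

(** Monotonicity against the nearby graph points bounds [ip (x k) (- v)] below by [- ip y v] up to a
    multiple of [e]; this bound is linear in [x k], so it passes to the tail hull. *)
Lemma tail_hull_zer z (f : nat -> nat) q : M z 0 ->
  (forall n, (n <= f n)%N) -> tail_hull ip (x \o f) q -> M q 0.
Proof.
move=> Mz fn hq; apply: Mmax.2 => y v Myv.
pose D := nrm (y - z) + nrm (x 0%N - z).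
apply: (@le_of_le_addeps _ _ _ (3 * nrm v + 2 * (D + 3))).
  by rewrite addr_ge0 ?mulr_ge0 ?hnorm_ge0// !addr_ge0 ?hnorm_ge0.
move=> e /andP[e0 e1]; have [K HK] := near_graph Mz e0.
suff : - ip y v - (3 * nrm v + 2 * (D + 3)) * e <= ip q (- v).
  by rewrite !ipE; lra.
apply: hq; exists K => n Kn /=.
have {HK} := HK _ (leq_trans Kn (fn n)); move: (f n) => k [y' [om [Mom [omb xy]]]].
have H1 := Mmax.1 _ _ _ _ Myv Mom.
have H2 : ip (x k - y') v <= 3 * e * nrm v.
  by apply: le_trans (ip_le_hnorm HV _ _) _; rewrite ler_wpM2r ?hnorm_ge0.
have H3 : nrm (y - y') <= D + 3.
  apply: le_trans (ler_hdist HV (x k) _ _) _.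
  have := ler_hdist HV z y (x k); rewrite (hnormBC HV z) /D.
  by have := fejer_bound k Mz; lra.
have H4 : - ip (y - y') om <= (D + 3) * (2 * e).
  apply: le_trans (ipN_le_hnorm HV _ _) _.
  by apply: ler_pM => //; exact: hnorm_ge0.
move: H1 H2 H4; rewrite !ipE; lra.
Qed.

Lemma method1_weak_cvg z : M z 0 -> exists xs, M xs 0 /\ weak_cvg ip x xs.
Proof.
move=> Mz; apply: (opial HV (S := fun z => M z 0) Mz).
  by move=> ? ? ?; exact: fejer_le.
by move=> f fn q; exact: tail_hull_zer Mz fn.
Qed.

End Method.

Theorem theorem4p9 (R : realType) (V : lmodType R) (ip : V -> V -> R)
    (HV : is_hilbert ip)
    (A1 A2 : V -> V) (B : V -> V -> Prop) (beta : R)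
    (Hbeta : 0 < beta) (HA1 : cocoercive ip beta A1)
    (HA2 : h_max_monotone ip (op_graph A2)) (HA2c : h_unif_cont ip A2)
    (HB : h_max_monotone ip B)
    (Hzer : exists z, zer (fun v => A1 v + A2 v) B z)
    (theta delta dbar am1 : R)
    (Htheta : 0 < theta < 1) (Hdelta : 0 < delta < 1) (Hdbar : 0 < dbar)
    (Hdd : 0 < 1 - delta - dbar) (Ham1 : 0 < am1) (Ham1b : am1 <= 4 * beta * dbar)
    (x0 : V) (x : nat -> V) (alpha : nat -> R) (xb : nat -> V)
    (Hmeth : method1 ip A1 A2 B theta delta dbar x0 am1 x alpha xb)
    (Hnostop : forall k : nat, x k.+1 <> x k) :
  exists xs : V, zer (fun v => A1 v + A2 v) B xs /\ weak_cvg ip x xs.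
Proof.
have [z /zerE Mz] := Hzer.
have [xs [Mxs xscvg]] := method1_weak_cvg HV Hbeta HA1 HA2 HA2c HB Htheta
  Hdelta Hdd Ham1 Ham1b Hmeth Hnostop Mz.
by exists xs; split=> //; apply/zerE.
Qed.
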